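(* Let $G$ be a homogeneous group with Lie algebra $\mathfrak{g}$, let $A, B \in \mathrm{GL}(\mathfrak{g})$ be admissible matrices, and let $\rho_A$, $\rho_B$ be homogeneous quasi-norms on $G$ associated with $A$ and $B$, respectively. Then there exists a constant $C>0$ such that $C^{-1}\rho_B(x)\le\rho_A(x)\le C\rho_B(x)$ for all $x\in G$ if and only if $A = B$.
   Context: A matrix (linear map) $A \in \mathrm{GL}(\mathfrak{g})$ is called admissible if it is diagonalizable (over $\mathbb{R}$), has only positive eigenvalues, and $\exp(\ln(r) A)$ is an automorphism of the Lie algebra $\mathfrak{g}$ for every $r>0$. A homogeneous group is a connected, simply connected nilpotent (real, finite-dimensional) Lie group $G$ whose Lie algebra $\mathfrak{g}$ possesses an admissible matrix. The exponential map $\exp_G\colon \mathfrak{g}\to G$ is a global diffeomorphism. For admissible $A$ and $r>0$, $\delta_r^A$ denotes both the automorphism $\exp(\ln(r)A)$ of $\mathfrak{g}$ and the group automorphism $\exp_G\circ\exp(\ln(r)A)\circ\exp_G^{-1}$ of $G$. A homogeneous quasi-norm associated with an admissible matrix $A$ is a continuous function $\rho_A\colon G\to[0,\infty)$, smooth on $G\setminus\{e\}$ ($e$ the identity of $G$), such that for all $x\in G$ and $r>0$: (1) $\rho_A(x^{-1})=\rho_A(x)$; (2) $\rho_A(\delta_r^A x)=r\rho_A(x)$; (3) $\rho_A(x)=0$ if and only if $x=e$. *)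

(* Defs.v *)
From HB Require Import structures.
From mathcomp Require Import all_boot all_order all_algebra.
From mathcomp Require Import all_classical all_reals all_analysis.
Set Implicit Arguments.
Unset Strict Implicit.
Unset Printing Implicit Defensive.
Import Order.TTheory GRing.Theory Num.Theory.
Import numFieldNormedType.Exports.
Local Open Scope classical_set_scope.
Local Open Scope ring_scope.

(* Only used for finite-dimensional V and open U, where iterated directional
   derivatives determine all higher Frechet derivatives. *)
Fixpoint Ck (R : realType) (V W : normedModType R) (k : nat) (U : set V)
    (f : V -> W) : Prop :=
  if k is k'.+1 then
    (forall x, U x -> differentiable f x) /\
    (forall v : V, Ck k' U (fun x => 'D_v f x))
  else forall x, U x -> {for x, continuous f}.

Definition Cinfty (R : realType) (V W : normedModType R) (U : set V)
  (f : V -> W) : Prop := forall k, Ck k U f.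

(* [cfun] and [cinv] are total functions, meaningful only on [cdom] and on
   [cfun @` cdom] respectively. *)
Record chart (R : realType) (M : topologicalType) (V : normedModType R) :=
  Chart { cdom : set M ; cfun : M -> V ; cinv : V -> M }.

Definition is_chart (R : realType) (M : topologicalType) (V : normedModType R)
    (c : chart M V) : Prop :=
  [/\ open (cdom c), open (cfun c @` cdom c),
      (forall x, cdom c x -> cinv c (cfun c x) = x),
      (forall x, cdom c x -> {for x, continuous (cfun c)}) &
      (forall y, (cfun c @` cdom c) y -> {for y, continuous (cinv c)})].

Definition is_atlas (R : realType) (M : topologicalType) (V : normedModType R)
    (a : set (chart M V)) : Prop :=
  [/\ (forall c, a c -> is_chart c),
      (forall x, exists2 c, a c & cdom c x) &
      (forall c d, a c -> a d ->
         Cinfty (cfun c @` (cdom c `&` cdom d)) (cfun d \o cinv c))].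

Definition self_atlas (R : realType) (V : normedModType R) :
  set (chart V V) := [set Chart setT id id].

Definition prod_chart (R : realType) (M N : topologicalType)
    (V W : normedModType R) (c : chart M V) (d : chart N W) :
    chart (M * N)%type (V * W)%type :=
  Chart (cdom c `*` cdom d) (fun p => (cfun c p.1, cfun d p.2))
        (fun q => (cinv c q.1, cinv d q.2)).

Definition prod_atlas (R : realType) (M N : topologicalType)
    (V W : normedModType R) (a : set (chart M V)) (b : set (chart N W)) :
    set (chart (M * N)%type (V * W)%type) :=
  [set e | exists c d, [/\ a c, b d & e = prod_chart c d]].

(* Smoothness of f on the open set U of M. *)
Definition smooth_on (R : realType) (M N : topologicalType)
    (V W : normedModType R) (a : set (chart M V)) (b : set (chart N W))
    (U : set M) (f : M -> N) : Prop :=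
  (forall x, U x -> {for x, continuous f}) /\
  (forall c d, a c -> b d ->
     Cinfty (cfun c @` (cdom c `&` U `&` f @^-1` cdom d))
            (cfun d \o f \o cinv c)).

HB.mixin Record isLieGroup (R : realType) (n : nat) G
    of Topological G & Group G := {
  atlas : set (chart G 'rV[R]_n) ;
  atlasP : is_atlas atlas ;
  lie_hausdorff : hausdorff_space G ;
  lie_second_countable : @second_countable G ;
  mul_smooth : smooth_on (prod_atlas atlas atlas) atlas setT
    (fun p : G * G => (p.1 * p.2)%g) ;
  inv_smooth : smooth_on atlas atlas setT (fun x : G => (x^-1)%g)
}.

#[short(type="lieGroupType")]
HB.structure Definition LieGroup (R : realType) (n : nat) :=
  {G of Topological G & Group G & isLieGroup R n G}.

Definition smooth_fun (R : realType) (n : nat) (G : lieGroupType R n)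
    (U : set G) (f : G -> R) : Prop :=
  smooth_on (@atlas R n G) (@self_atlas R R^o) U f.

(* Vector fields on G as derivations of the algebra of smooth functions; only
   the values on smooth functions matter. *)
Definition vector_field (R : realType) (n : nat) (G : lieGroupType R n)
    (X : (G -> R) -> G -> R) : Prop :=
  [/\ forall f, smooth_fun setT f -> smooth_fun setT (X f),
      forall (a : R) f h, smooth_fun setT f -> smooth_fun setT h ->
        X (fun x => a * f x + h x) = (fun x => a * X f x + X h x) &
      forall f h, smooth_fun setT f -> smooth_fun setT h ->
        X (fun x => f x * h x) = (fun x => f x * X h x + h x * X f x)].

Definition left_invariant (R : realType) (n : nat) (G : lieGroupType R n)
    (X : (G -> R) -> G -> R) : Prop :=
  forall (y : G) f, smooth_fun setT f ->
    X (fun x => f (y * x)%g) = (fun x => X f (y * x)%g).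

(* The Lie algebra of G (left-invariant vector fields with the commutator
   bracket), read in an arbitrary basis: [lvf] is the linear isomorphism from
   coordinate vectors onto left-invariant vector fields. *)
Record lieAlgebra (R : realType) (n : nat) (G : lieGroupType R n) :=
  LieAlgebra {
    lvf : 'rV[R]_n -> (G -> R) -> G -> R ;
    lie : 'rV[R]_n -> 'rV[R]_n -> 'rV[R]_n ;
    lvf_field : forall v, vector_field (lvf v) ;
    lvf_left_invariant : forall v, left_invariant (lvf v) ;
    lvf_linear : forall (a : R) u v f, smooth_fun setT f ->
      lvf (a *: u + v) f = (fun x => a * lvf u f x + lvf v f x) ;
    lvf_inj : forall v, (forall f x, smooth_fun setT f -> lvf v f x = 0) ->
      v = 0 ;
    lvf_surj : forall X, vector_field X -> left_invariant X ->
      exists v, forall f, smooth_fun setT f -> X f = lvf v f ;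
    lieE : forall u v f, smooth_fun setT f ->
      lvf (lie u v) f = (fun x => lvf u (lvf v f) x - lvf v (lvf u f) x)
  }.

Definition one_parameter_subgroup (R : realType) (n : nat)
    (G : lieGroupType R n) (g : lieAlgebra G) (v : 'rV[R]_n) (c : R -> G) :
    Prop :=
  [/\ smooth_on (@self_atlas R R^o) (@atlas R n G) setT (c : R^o -> G),
      forall s t, c (s + t) = (c s * c t)%g &
      forall f, smooth_fun setT f -> derive1 (f \o c : R -> R^o) 0 = lvf g v f 1%g].

Definition expG (R : realType) (n : nat) (G : lieGroupType R n)
    (g : lieAlgebra G) (v : 'rV[R]_n) : G :=
  xget 1%g [set x | exists2 c, one_parameter_subgroup g v c & c 1 = x].

(* The inverse of expG, when expG is bijective. *)
Definition logG (R : realType) (n : nat) (G : lieGroupType R n)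
    (g : lieAlgebra G) (x : G) : 'rV[R]_n :=
  xget 0 [set v | expG g v = x].

Definition global_diffeomorphism (R : realType) (M N : topologicalType)
    (V W : normedModType R) (a : set (chart M V)) (b : set (chart N W))
    (f : M -> N) : Prop :=
  smooth_on a b setT f /\
  exists h : N -> M, [/\ cancel f h, cancel h f & smooth_on b a setT h].

Definition simply_connected (R : realType) (T : topologicalType) : Prop :=
  forall c : R -> T, {within `[0, 1], continuous c} -> c 0 = c 1 ->
  exists H : R * R -> T,
    [/\ {within `[0, 1] `*` `[0, 1], continuous H},
        forall t, t \in `[0, 1] -> H (0, t) = c t,
        forall t, t \in `[0, 1] -> H (1, t) = c 0 &
        forall s, s \in `[0, 1] -> H (s, 0) = c 0 /\ H (s, 1) = c 0].

Definition is_subgroup (G : groupType) (H : set G) : Prop :=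
  [/\ H 1%g, forall x y, H x -> H y -> H (x * y)%g & forall x, H x -> H x^-1%g].

Fixpoint lower_central (G : groupType) (k : nat) : set G :=
  if k is k'.+1 then
    smallest (@is_subgroup G)
      [set z | exists x y, lower_central k' y /\ z = [~ x, y]%g]
  else setT.

Definition nilpotent_group (G : groupType) : Prop :=
  exists k, @lower_central G k = [set 1%g].

Definition expmx (R : realType) (n : nat) (A : 'M[R]_n) : 'M[R]_n :=
  lim (series (fun k : nat => k`!%:R^-1 *: A ^+ k) @ \oo).

(* Matrices act on coordinate row vectors by v |-> v *m A. *)
Definition lie_automorphism (R : realType) (n : nat) (G : lieGroupType R n)
    (g : lieAlgebra G) (M : 'M[R]_n) : Prop :=
  M \in unitmx /\ forall u v, lie g u v *m M = lie g (u *m M) (v *m M).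

Definition admissible (R : realType) (n : nat) (G : lieGroupType R n)
    (g : lieAlgebra G) (A : 'M[R]_n) : Prop :=
  [/\ A \in unitmx, diagonalizable A, forall a, eigenvalue A a -> 0 < a &
      forall r, 0 < r -> lie_automorphism g (expmx (ln r *: A))].

Definition homogeneous_group (R : realType) (n : nat) (G : lieGroupType R n)
    (g : lieAlgebra G) : Prop :=
  [/\ connected [set: G], simply_connected R G, nilpotent_group G &
      exists A, admissible g A].

Definition dilation (R : realType) (n : nat) (G : lieGroupType R n)
    (g : lieAlgebra G) (A : 'M[R]_n) (r : R) (x : G) : G :=
  expG g (logG g x *m expmx (ln r *: A)).

Definition homogeneous_quasi_norm (R : realType) (n : nat)
    (G : lieGroupType R n) (g : lieAlgebra G) (A : 'M[R]_n) (rho : G -> R) :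
    Prop :=
  [/\ (forall x, 0 <= rho x) /\ continuous rho,
      smooth_fun (~` [set 1%g]) rho,
      forall x, rho x^-1%g = rho x,
      forall x r, 0 < r -> rho (dilation g A r x) = r * rho x &
      forall x, rho x = 0 <-> x = 1%g].

(* Main.v *)
Require Import Defs.
From mathcomp Require Import all_boot all_order all_algebra.
From mathcomp Require Import all_classical all_reals all_analysis.
Set Implicit Arguments.
Unset Strict Implicit.
Unset Printing Implicit Defensive.
Import Order.TTheory GRing.Theory Num.Theory.
Import numFieldNormedType.Exports.
Local Open Scope classical_set_scope.
Local Open Scope ring_scope.

(** Write [E_t] for the matrix [expmx (t *: A)] and transport the quasi-norms
    to the Lie algebra through the bijection [expG g]. In coordinates [w]
    along eigenvectors of [A], with eigenvalues [d i > 0], the dilation [E_t]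
    multiplies [w i] by [expR (t * d i)]. The explicit function
    [gauge d w = max_i |w i| `^ (1 / d i)] scales in the same way, and every
    nonzero orbit of the dilations meets the compact unit sphere of the sup
    norm, namely at the point of gauge [1]. Hence any continuous, homogeneous
    function that is positive away from [0] is squeezed between two multiples
    of the gauge ([gauge_comparison], [quasi_norm_gauge]).

    If [A = B], both quasi-norms are comparable to the same gauge, hence to
    each other ([quasi_norms_comparable]).

    Conversely, suppose [rhoA <= C * rhoB], and let [v] be an eigenvector of
    [B] with eigenvalue [b]. Along the orbit [expR (s * b) *: v] of [v] under
    the [B]-dilations, [rhoB] grows exactly like [expR s], so the gauge of [A]
    grows at most like [expR s]. But the part of [v] along an eigenvector of
    [A] with eigenvalue [a] contributes a constant times [expR (s * b / a)] to
    that gauge. Letting [s] run over all of [R], to both infinities, forces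
    [a = b] whenever that part is nonzero. So [v] is an eigenvector of [A] with
    eigenvalue [b]; such [v] form a basis, and [A = B]
    ([eq_of_quasi_norm_le]). *)

(** * Entrywise convergence of matrices *)

Lemma cvg_mx_coord (R : realType) (m n : nat) (T : Type) (F : set_system T)
    (f : T -> 'M[R]_(m, n)) (M : 'M[R]_(m, n)) :
  Filter F -> (forall i j, f x i j @[x --> F] --> M i j) ->
  f x @[x --> F] --> M.
Proof.
move=> FF fM A [P MP sPA].
have : \forall x \near F, forall i, forall j, P i j (f x i j).
  by apply: filter_forall => i; apply: filter_forall => j; exact: fM (MP i j).
by apply: filterS => x Px; exact: sPA.
Qed.

Lemma cvg_sum_fin (R : realType) (I T : Type) (F : set_system T) (r : seq I)
    (f : I -> T -> R) (l : I -> R) :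
  Filter F -> (forall i, f i x @[x --> F] --> l i) ->
  \sum_(i <- r) f i x @[x --> F] --> \sum_(i <- r) l i.
Proof.
move=> FF fl; elim: r => [|i r IH].
  by rewrite big_nil; under eq_fun do rewrite big_nil; exact: cvg_cst.
by rewrite big_cons; under eq_fun do rewrite big_cons; exact: cvgD.
Qed.

Lemma cvg_mulmx (R : realType) (m n p : nat) (T : Type) (F : set_system T)
    (f : T -> 'M[R]_(m, n)) (g : T -> 'M[R]_(n, p))
    (M : 'M[R]_(m, n)) (N : 'M[R]_(n, p)) :
  Filter F -> f x @[x --> F] --> M -> g x @[x --> F] --> N ->
  f x *m g x @[x --> F] --> M *m N.
Proof.
move=> FF fM gN; apply: cvg_mx_coord => i j; rewrite mxE.
under eq_fun do rewrite mxE.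
apply: cvg_sum_fin => k; apply: cvgM.
- exact: (cvg_comp f _ fM (@coord_continuous R m n i k M)).
- exact: (cvg_comp g _ gN (@coord_continuous R n p k j N)).
Qed.

(** * Exponentials of diagonalizable matrices *)

(** This is [expmx (t *: A)] read in a basis of eigenvectors of [A] with
    eigenvalues [d]; acting by dilations means taking [t = ln r]. *)
Definition flow_mx (R : realType) (n : nat) (d : 'rV[R]_n) (t : R) : 'M[R]_n :=
  diag_mx (\row_i expR (t * d 0 i)).

(** The power series is diagonal in the eigenbasis and its partial sums there
    are those of the scalar exponentials, so that convergence is entrywise. *)
Lemma expmx_diagonalized (R : realType) (n : nat) (P A : 'M[R]_n)
    (d : 'rV[R]_n) (t : R) :
  P \in unitmx -> P *m A = diag_mx d *m P ->
  P *m expmx (t *: A) = flow_mx d t *m P.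
Proof.
move=> uP PA.
have PX k : P *m (t *: A) ^+ k = diag_mx (\row_i (t * d 0 i) ^+ k) *m P.
  elim: k => [|k IH].
    rewrite expr0 (_ : diag_mx _ = 1%:M) ?mul1mx ?mulmx1//.
    by apply/matrixP => i j; rewrite !mxE expr0.
  rewrite exprS -mulmxE mulmxA -scalemxAr PA scalemxAl -mulmxA IH mulmxA.
  congr (_ *m _); rewrite -scalemxAl mulmx_diag.
  apply/matrixP => i j; rewrite !mxE exprS -mulrnAr mulrnAr -mulrA.
  by rewrite !mulrnAr mulrA.
pose S N : 'M[R]_n := series (fun k : nat => k`!%:R^-1 *: (t *: A) ^+ k) N.
have SE N : S N =
    invmx P *m (diag_mx (\row_i series (exp_coeff (t * d 0 i)) N) *m P).
  rewrite -[LHS]mul1mx -(mulVmx uP) -mulmxA; congr (_ *m _).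
  rewrite /S /series /= mulmx_sumr (eq_bigr (fun k : nat =>
    diag_mx (\row_i exp_coeff (t * d 0 i) k) *m P)) => [|k _].
    rewrite -mulmx_suml; congr (_ *m _).
    apply/matrixP => i j; rewrite summxE !mxE -sumrMnl.
    by apply: eq_bigr => k _; rewrite !mxE.
  rewrite -scalemxAr PX scalemxAl; congr (_ *m _).
  apply/matrixP => i j; rewrite !mxE mulrnAr /exp_coeff.
  by rewrite mulrC.
have Scvg : S N @[N --> \oo] --> invmx P *m (flow_mx d t *m P).
  under eq_fun do rewrite SE.
  apply: (@cvg_mulmx _ _ _ _ _ _ (fun=> invmx P)); first exact: cvg_cst.
  apply: (@cvg_mulmx _ _ _ _ _ _ _ (fun=> P)); last exact: cvg_cst.
  apply: cvg_mx_coord => i j; rewrite !mxE; under eq_fun do rewrite !mxE.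
  case: (i == j); rewrite ?mulr1n ?mulr0n; last exact: cvg_cst.
  exact: is_cvg_series_exp_coeff.
have -> : expmx (t *: A) = invmx P *m (flow_mx d t *m P).
  by apply: cvg_lim Scvg; exact: norm_hausdorff.
by rewrite mulKVmx.
Qed.

(** * The gauge of a diagonal dilation group *)

(** The exponents are chosen so that the diagonal dilations [flow_mx d t]
    scale every term of the maximum by the same factor [expR t]. *)
Definition gauge (R : realType) (n : nat) (d w : 'rV[R]_n) : R :=
  \big[Num.max/0]_i `|w 0 i| `^ (d 0 i)^-1.

Section Gauge.
Variables (R : realType) (n : nat) (d : 'rV[R]_n).
Hypothesis d_gt0 : forall i, 0 < d 0 i.

Lemma gauge_flow (w : 'rV[R]_n) t :
  gauge d (w *m flow_mx d t) = expR t * gauge d w.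
Proof.
rewrite /gauge mul_mx_diag.
elim/big_ind2: _ => [|x1 x2 y1 y2 -> ->|i _]; first by rewrite mulr0.
  by rewrite maxr_pMr ?expR_ge0.
rewrite !mxE normrM powRM ?normr_ge0// mulrC; congr (_ * _).
by rewrite (ger0_norm (expR_ge0 _)) -expRM mulfK ?gt_eqF.
Qed.

Lemma ge_gauge (w : 'rV[R]_n) i : `|w 0 i| `^ (d 0 i)^-1 <= gauge d w.
Proof. by rewrite /gauge (le_bigmax _ (fun i => _ `^ _)). Qed.

Lemma gauge_gt0 (w : 'rV[R]_n) : w != 0 -> 0 < gauge d w.
Proof.
move=> /rV0Pn[i wi]; apply: lt_le_trans (ge_gauge w i).
by rewrite powR_gt0 ?normr_gt0.
Qed.

Lemma gauge0 : gauge d 0 = 0.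
Proof.
rewrite /gauge big1_idem => // [|i _]; first exact: maxxx.
by rewrite mxE normr0 powR0 // invr_eq0 gt_eqF.
Qed.

(** The unit sphere of the gauge lies in the unit sphere of the sup norm,
    since [x `^ a] and [x] lie on the same side of [1] when [a > 0]. *)
Lemma norm_of_gauge1 (w : 'rV[R]_n) : gauge d w = 1 -> `|w| = 1.
Proof.
have p1 a : (1 : R) `^ a = 1 by rewrite powR1.
move=> w1; rewrite /Num.Def.normr/= mx_normrE; apply/le_anti/andP; split.
  apply/bigmax_leP; split=> // -[k i] _ /=; rewrite (ord1 k) leNgt.
  apply/negP => wi; have := ge_gauge w i; rewrite w1 leNgt => /negP; apply.
  by rewrite -[ltLHS](p1 (d 0 i)^-1) gt0_ltr_powR ?invr_gt0// ?nnegrE.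
have /bigmax_geP[|[i _ wi]] : 1 <= gauge d w by rewrite w1.
  by rewrite ler10.
apply: (bigmax_sup (0, i)) => //=; rewrite leNgt; apply/negP => wi1.
move: wi; rewrite leNgt => /negP; apply.
by rewrite -[ltRHS](p1 (d 0 i)^-1) gt0_ltr_powR ?invr_gt0// ?nnegrE.
Qed.

(** [f] and the gauge are both homogeneous, so it is enough to compare them on
    the points of gauge [1]; these have sup norm [1], and [f] is bounded above
    and away from [0] on that compact sphere. *)
Lemma gauge_comparison (f : 'rV[R]_n -> R) :
  continuous f -> (forall w, 0 <= f w) -> (forall w, f w = 0 <-> w = 0) ->
  (forall w t, f (w *m flow_mx d t) = expR t * f w) ->
  exists2 C, 0 < C & forall w, C^-1 * gauge d w <= f w <= C * gauge d w.
Proof.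
move=> fc f0 fE fh.
pose S := [set w : 'rV[R]_n | `|w| = 1].
have cS : compact S.
  apply: bounded_closed_compact.
    by exists 1; split=> // x x1 w /= ->; exact: ltW.
  apply: (@preimage_closed _ _ _ [set (1 : R)]); last exact: closed_eq.
  by move=> w _; exact: norm_continuous.
have fS w : S w -> 0 < f w.
  move=> Sw; rewrite lt_neqAle f0 andbT eq_sym; apply/eqP => /fE w0.
  by move: Sw; rewrite w0 /S/= normr0 => /esym/eqP; rewrite oner_eq0.
have [C C0 CS] : exists2 C, 0 < C & forall w, S w -> C^-1 <= f w <= C.
  (* the sphere is empty in dimension 0 *)
  have [S0|/set0P/negP/negPn/eqP->] := pselect (S !=set0); last by exists 1.
  have [a aS fa] := compact_EVT_min S0 cS (continuous_subspaceT fc).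
  have [b bS fb] := compact_EVT_max S0 cS (continuous_subspaceT fc).
  have fa0 : 0 < f a by apply: fS; exact/set_mem.
  have C0 : 0 < Num.max (f a)^-1 (f b) by rewrite lt_max invr_gt0 fa0.
  exists (Num.max (f a)^-1 (f b)) => // w /mem_set wS.
  rewrite le_max fb// orbT andbT (le_trans _ (fa w wS))//.
  by rewrite invf_ple ?posrE// le_max lexx.
exists C => // w; have [->|w0] := eqVneq w 0.
  by rewrite gauge0 (fE 0).2// !mulr0 lexx.
have g0 := gauge_gt0 w0.
(* the time at which the dilation orbit of [w] meets the unit sphere *)
set t := - ln (gauge d w).
have et : expR t = (gauge d w)^-1 by rewrite expRN lnK.
have /CS : S (w *m flow_mx d t).
  by apply: norm_of_gauge1; rewrite gauge_flow et mulVf ?gt_eqF.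
by rewrite fh et ler_pdivlMl// ler_pdivrMl// [_ * C^-1]mulrC [_ * C]mulrC.
Qed.

End Gauge.

(** * Quasi-norms in eigencoordinates *)

Section Diagonalized.
Variables (R : realType) (n : nat) (G : lieGroupType R n) (g : lieAlgebra G).

Lemma admissible_diagonalized (A : 'M[R]_n) : admissible g A ->
  exists P d, [/\ P \in unitmx, P *m A = diag_mx d *m P & forall i, 0 < d 0 i].
Proof.
move=> [_ [P uP /diagonalizable_forPex[d /(simmxP uP) PA]] evA _].
exists P, d; split=> // i; apply: evA; apply/eigenvalueP; exists (row i P).
  by rewrite -row_mul PA row_mul row_diag_mx -scalemxAl -rowE.
apply/negP => /eqP Pi0; have := congr1 (row i) (mulmxV uP).
rewrite row_mul Pi0 mul0mx row1 => /rowP/(_ i)/eqP.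
by rewrite !mxE !eqxx eq_sym oner_eq0.
Qed.

Hypothesis hexp : global_diffeomorphism (@self_atlas R 'rV[R]_n)
  (@atlas R n G) (expG g).

Lemma expGK v : logG g (expG g v) = v.
Proof.
have [_ [h [expK _ _]]] := hexp.
rewrite /logG; apply: (can_inj expK).
exact: (@xgetPex _ 0 [set u | expG g u = expG g v] (ex_intro _ v erefl)).
Qed.

Lemma expG_surj x : exists v, expG g v = x.
Proof. by have [_ [h [_ hK _]]] := hexp; exists (h x). Qed.

(** The homogeneity axiom in eigencoordinates, with the dilation parameter
    [r = expR t]. *)
Lemma quasi_norm_flow (A P : 'M[R]_n) (d w : 'rV[R]_n) (rho : G -> R) t :
  homogeneous_quasi_norm g A rho ->
  P \in unitmx -> P *m A = diag_mx d *m P ->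
  rho (expG g (w *m flow_mx d t *m P)) = expR t * rho (expG g (w *m P)).
Proof.
move=> [_ _ _ rhoh _] uP PA; rewrite -rhoh ?expR_gt0// /dilation expGK expRK.
by rewrite -!mulmxA (expmx_diagonalized _ uP PA).
Qed.

(** The vector [0] is fixed by every dilation, so a quasi-norm satisfies
    [rho (expG g 0) = r * rho (expG g 0)] for all [r > 0]. It therefore vanishes
    at [expG g 0], which identifies this point without studying the
    one-parameter subgroups that define [expG]. *)
Lemma expG0 (A : 'M[R]_n) (rho : G -> R) :
  admissible g A -> homogeneous_quasi_norm g A rho -> expG g 0 = 1%g.
Proof.
move=> /admissible_diagonalized[P [d [uP PA _]]] rhoP.
have := quasi_norm_flow 0 1 rhoP uP PA; rewrite !mul0mx => /eqP.
rewrite -subr_eq0 -{1}[rho _]mul1r -mulrBl mulf_eq0 subr_eq0 eq_sym.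
by rewrite gt_eqF ?expR_gt1//= => /eqP; case: rhoP => _ _ _ _ rho0 /rho0.
Qed.

Lemma quasi_norm_gauge (A P : 'M[R]_n) (d : 'rV[R]_n) (rho : G -> R) :
  admissible g A -> homogeneous_quasi_norm g A rho ->
  P \in unitmx -> P *m A = diag_mx d *m P -> (forall i, 0 < d 0 i) ->
  exists2 C, 0 < C & forall w,
    C^-1 * gauge d w <= rho (expG g (w *m P)) <= C * gauge d w.
Proof.
move=> hA rhoP uP PA d0.
have exp0 := expG0 hA rhoP.
apply: (@gauge_comparison _ _ d d0 (fun w => rho (expG g (w *m P)))).
- move=> w; have [[_ crho] _ _ _ _] := rhoP.
  have [[cexp _] _] := hexp.
  have cP : {for w, continuous (fun w : 'rV[R]_n => w *m P)}.
    apply: (@cvg_mulmx _ _ _ _ _ (nbhs w) id (fun=> P)); first exact: cvg_id.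
    exact: cvg_cst.
  apply: (continuous_comp (g := rho \o expG g) cP).
  exact: continuous_comp (cexp _ I) (crho _).
- by move=> w; case: rhoP => -[].
- move=> w; case: rhoP => _ _ _ _ ->; split=> [|->]; last by rewrite mul0mx.
  rewrite -exp0 => /(congr1 (logG g)); rewrite !expGK => wP.
  by rewrite -[w](mulmxK uP) wP mul0mx.
- by move=> w t; exact: quasi_norm_flow rhoP uP PA.
Qed.

End Diagonalized.

(** An exponential bounded on the whole line is constant: with [c != 0], the
    inequality [1 + y <= expR y] at [y = t * c = K / x] already exceeds [K]. *)
Lemma expR_mul_bounded (R : realType) (x c K : R) :
  0 < x -> (forall t, x * expR (t * c) <= K) -> c = 0.
Proof.
move=> x0 xK; have [//|c0] := eqVneq c 0.
have := xK (K / x / c); rewrite divfK// => xeK.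
have : x * (1 + K / x) <= K.
  by apply: le_trans xeK; rewrite ler_pM2l// expR_ge1Dx.
rewrite mulrDr mulr1 mulrCA divff ?gt_eqF// mulr1 -lerBrDr subrr.
by rewrite leNgt x0.
Qed.

(** * Comparable quasi-norms *)

Section Comparison.
Variables (R : realType) (n : nat) (G : lieGroupType R n) (g : lieAlgebra G).
Hypothesis hexp : global_diffeomorphism (@self_atlas R 'rV[R]_n)
  (@atlas R n G) (expG g).

Lemma quasi_norms_comparable (A : 'M[R]_n) (rho1 rho2 : G -> R) :
  admissible g A ->
  homogeneous_quasi_norm g A rho1 -> homogeneous_quasi_norm g A rho2 ->
  exists C : R, 0 < C /\ forall x : G, C^-1 * rho2 x <= rho1 x <= C * rho2 x.
Proof.
move=> hA hrho1 hrho2; have [P [d [uP PA d0]]] := admissible_diagonalized hA.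
have [C C0 rho1C] := quasi_norm_gauge hexp hA hrho1 uP PA d0.
have [D D0 rho2D] := quasi_norm_gauge hexp hA hrho2 uP PA d0.
exists (C * D); split=> [|x]; first exact: mulr_gt0.
have [v <-] := expG_surj hexp x; rewrite -(mulmxKV uP v).
set w := v *m invmx P.
have /andP[lo1 up1] := rho1C w; have /andP[lo2 up2] := rho2D w.
apply/andP; split.
  apply: le_trans lo1; rewrite invfM -mulrA ler_pM2l ?invr_gt0//.
  by rewrite ler_pdivrMl.
apply: (le_trans up1); rewrite -mulrA ler_pM2l//.
by rewrite -ler_pdivrMl.
Qed.

(** One inequality suffices: both signs of [s] in [expR (s * b)] are at hand,
    so the growth at infinity and the decay at the identity are compared. *)
Lemma eq_of_quasi_norm_le (A B : 'M[R]_n) (rhoA rhoB : G -> R) (C : R) :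
  admissible g A -> admissible g B ->
  homogeneous_quasi_norm g A rhoA -> homogeneous_quasi_norm g B rhoB ->
  (forall x, rhoA x <= C * rhoB x) -> A = B.
Proof.
move=> hA hB hrhoA hrhoB AB.
have [P [a [uP PA a0]]] := admissible_diagonalized hA.
have [Q [b [uQ QB b0]]] := admissible_diagonalized hB.
have [D D0 DA] := quasi_norm_gauge hexp hA hrhoA uP PA a0.
suff QA i : row i (Q *m A) = row i (Q *m B).
  by apply: (can_inj (mulKmx uQ)); apply/row_matrixP.
have [w wP] : exists w, w *m P = row i Q.
  by exists (row i Q *m invmx P); rewrite mulmxKV.
pose K := D * (C * rhoB (expG g (row i Q))).
(* the [j]-th term of the gauge of [A] along the [B]-orbit of [w *m P], divided
   by the growth [expR s] of [rhoB] on that orbit *)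
have wK s j : `|w 0 j| `^ (a 0 j)^-1 * expR (s * (b 0 i / a 0 j - 1)) <= K.
  have eQ : expR (s * b 0 i) *: w *m P =
      (delta_mx 0 i : 'rV[R]_n) *m flow_mx b s *m Q.
    rewrite -scalemxAl wP -[delta_mx 0 i]row1 -row_mul mul1mx.
    by rewrite row_diag_mx -scalemxAl -rowE mxE.
  have := quasi_norm_flow hexp (delta_mx 0 i) s hrhoB uQ QB.
  rewrite -eQ -rowE => rhoBs.
  have /andP[+ _] := DA (expR (s * b 0 i) *: w).
  rewrite ler_pdivrMl// => gK; rewrite mulrBr mulr1 expRB mulrA.
  rewrite ler_pdivrMr ?expR_gt0//.
  have := le_trans (ge_gauge _ _ j) gK; rewrite mxE normrM.
  rewrite (ger0_norm (expR_ge0 _)) powRM ?expR_ge0// -expRM mulrA mulrC.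
  move=> /le_trans; apply; rewrite /K -mulrA ler_pM2l//.
  apply: le_trans (AB _) _.
  by rewrite rhoBs mulrCA mulrA [_ * expR s]mulrC mulrA.
have wa : w *m diag_mx a = b 0 i *: w.
  rewrite mul_mx_diag; apply/rowP => j; rewrite !mxE.
  have [->|wj] := eqVneq (w 0 j) 0; first by rewrite mul0r mulr0.
  have wj0 : 0 < `|w 0 j| `^ (a 0 j)^-1 by rewrite powR_gt0 ?normr_gt0.
  have /eqP := expR_mul_bounded wj0 (wK^~ j).
  rewrite subr_eq0 => /eqP/divr1_eq ->.
  by rewrite mulrC.
rewrite QB !row_mul row_diag_mx -scalemxAl -rowE.
by rewrite -wP -mulmxA PA mulmxA wa -scalemxAl.
Qed.

End Comparison.

Theorem proposition2p1 (R : realType) (n : nat) (G : lieGroupType R n)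
    (g : lieAlgebra G) (A B : 'M[R]_n) (rhoA rhoB : G -> R)
    (hG : homogeneous_group g)
    (hexp : global_diffeomorphism (@self_atlas R 'rV[R]_n) (@atlas R n G)
              (expG g))
    (hA : admissible g A) (hB : admissible g B)
    (hrhoA : homogeneous_quasi_norm g A rhoA)
    (hrhoB : homogeneous_quasi_norm g B rhoB) :
  (exists C : R, 0 < C /\
     forall x : G, C^-1 * rhoB x <= rhoA x <= C * rhoB x)
  <-> A = B.
Proof.
split=> [[C [_ CAB]]|AB].
  apply: (eq_of_quasi_norm_le (C := C) hexp hA hB hrhoA hrhoB) => x.
  by have /andP[] := CAB x.
rewrite -AB in hrhoB; exact: (quasi_norms_comparable hexp hA hrhoA hrhoB).
Qed.
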